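(* Let $R$ be a right Ore domain with classical right ring of fractions $Q$ and let $f\colon A_R\to B_R$ be a right $R$-module morphism. (1) If $f$ is $e$-epi, then $f\otimes 1\colon A\otimes_R Q\to B\otimes_R Q$ is surjective. (2) If $f\otimes 1\colon A\otimes_R Q\to B\otimes_R Q$ is surjective and $B$ is non-singular, then $f$ is $e$-epi. In particular, if $0\to A_R\to B_R \to C_R \to 0$ is a short $e$-exact sequence of right $R$-modules, then the sequence $0\to A_R\otimes_R Q \to B_R\otimes_R Q \to C_R \otimes_R Q\to 0$ is exact.
   Context: Rings are associative with identity $1\neq 0$, not necessarily commutative; modules are unitary right modules. A domain $R$ is right Ore if $aR\cap bR\neq 0$ for every pair of nonzero elements $a,b\in R$; its classical right ring of fractions $Q=Q^r_{cl}(R)$ is the division ring containing $R$ in which every element has the form $rs^{-1}$ with $r,s\in R$, $s\neq 0$. A submodule $N\le M$ is essential in $M$ if $N\cap X\neq 0$ for every nonzero submodule $X$ of $M$. A morphism $f\colon A\to B$ is $e$-epi if $f(A)$ is essential in $B$. A short $e$-exact sequence is a cochain complex $0\to A\xrightarrow{f}B\xrightarrow{g}C\to 0$ of right $R$-modules (so $gf=0$) such that $f$ is a monomorphism, $f(A)$ is an essential submodule of $\ker(g)$, and $g(B)$ is an essential submodule of $C$. A right $R$-module $M$ is non-singular if $Z(M)=0$, where $Z(M)=\{x\in M \mid xI=0 \text{ for some essential right ideal } I \text{ of } R\}$; for a right Ore domain, $Z(M)=\{m\in M\mid mr=0\text{ for some nonzero } r\in R\}$. *)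

(* Defs.v *)
From HB Require Import structures.
From mathcomp Require Import all_boot all_order all_algebra.
From mathcomp Require Import ring_quotient boolp classical_sets functions.
From mathcomp.multinomials Require Import freeg.

Set Implicit Arguments.
Unset Strict Implicit.
Unset Printing Implicit Defensive.

Import GRing.Theory.
Local Open Scope classical_set_scope.
Local Open Scope ring_scope.
Local Open Scope quotient_scope.

(* MathComp modules are left modules. A right R-module is an [lmodType R^c]
   over the converse ring, with [r *: m] standing for m.r; a right ideal of R
   is a submodule of [(R^c)^o]. *)

Section Submodules.
Variables (S : nzRingType) (M : lmodType S).

Definition submodule (X : set M) : Prop := GRing.submod_closed (mem X).

Definition essential (N K : set M) : Prop :=
  [/\ submodule N, submodule K, N `<=` K &
      forall X : set M, submodule X -> X `<=` K -> X <> [set 0] ->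
        N `&` X <> [set 0]].

End Submodules.

(* [GRing.integral_domain_axiom] and [GRing.field_axiom] do not entail
   commutativity: they say "no zero divisors" and "nonzero elements are
   two-sided units". *)
Section RightModules.
Variable R : nzRingType.

Definition right_ore_domain : Prop :=
  GRing.integral_domain_axiom R /\
  forall a b : R, a != 0 -> b != 0 ->
    range (fun r => a * r) `&` range (fun r => b * r) <> [set 0].

Definition e_epi (A B : lmodType R^c) (f : {linear A -> B}) : Prop :=
  essential (range f) [set: B].

Definition short_e_exact (A B C : lmodType R^c)
    (f : {linear A -> B}) (g : {linear B -> C}) : Prop :=
  [/\ injective f, forall x, g (f x) = 0,
      essential (range f) (g @^-1` [set 0]) & essential (range g) [set: C]].

Definition singular_submodule (M : lmodType R^c) : set M :=
  [set x | exists I : set (R^c)^o,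
     essential I [set: (R^c)^o] /\ forall r : R^c, I r -> r *: x = 0].
Arguments singular_submodule : clear implicits.

Definition nonsingular (M : lmodType R^c) : Prop :=
  singular_submodule M = [set 0].

Definition classical_right_fractions (Q : unitRingType)
    (iota : {rmorphism R -> Q}) : Prop :=
  [/\ GRing.field_axiom Q, injective iota &
      forall q : Q, exists r s : R, s != 0 /\ q = iota r / iota s].

End RightModules.

Definition short_exact (A B C : zmodType)
    (f : {additive A -> B}) (g : {additive B -> C}) : Prop :=
  [/\ injective f, range f = g @^-1` [set 0] &
      set_surj [set: B] [set: C] g].

(* Q as a left R-module by restriction of scalars along iota. *)
Definition res_scalars (R Q : nzRingType) (iota : {rmorphism R -> Q}) : Type :=
  Q.

Section RestrictionOfScalars.
Variables (R Q : nzRingType) (iota : {rmorphism R -> Q}).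
Local Notation V := (res_scalars iota).

HB.instance Definition _ := GRing.Zmodule.copy V Q.

Definition res_scale (r : R) (q : V) : V := iota r * (q : Q).

Fact res_scaleA r s q : res_scale r (res_scale s q) = res_scale (r * s) q.
Proof. by rewrite /res_scale rmorphM mulrA. Qed.
Fact res_scale1 : left_id 1 res_scale.
Proof. by move=> q; rewrite /res_scale rmorph1 mul1r. Qed.
Fact res_scaleDr : right_distributive res_scale +%R.
Proof. by move=> r p q; rewrite /res_scale mulrDr. Qed.
Fact res_scaleDl q : {morph res_scale^~ q : r s / r + s}.
Proof. by move=> r s; rewrite /res_scale rmorphD mulrDl. Qed.

HB.instance Definition _ := GRing.Zmodule_isLmodule.Build R V
  res_scaleA res_scale1 res_scaleDr res_scaleDl.

End RestrictionOfScalars.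

(* The tensor product of a right and a left module over a noncommutative
   ring, as an abelian group: the free abelian group on pairs modulo the
   subgroup generated by the balancedness relations. *)
Section Tensor.
Variables (R : nzRingType) (A : lmodType R^c) (V : lmodType R).

Definition balanced (W : zmodType) (b : A -> V -> W) : Prop :=
  [/\ forall a a' v, b (a + a') v = b a v + b a' v,
      forall a v v', b a (v + v') = b a v + b a v' &
      forall (r : R) a v, b ((r : R^c) *: a) v = b a (r *: v)].

Local Notation F := {freeg (A * V)%type / int}.
Local Notation "<[ a , v ]>" := (Freeg [:: (1%:Z, (a, v))] : F).

Definition tensor_relators : set F :=
  [set x | exists a a' v, x = <[a + a', v]> - (<[a, v]> + <[a', v]>)]
  `|` [set x | exists a v v', x = <[a, v + v']> - (<[a, v]> + <[a, v']>)]
  `|` [set x | exists (r : R) a v,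
         x = <[(r : R^c) *: a, v]> - <[a, r *: v]>].

Definition tensor_rel : {pred F} :=
  [in smallest (fun S : set F => zmod_closed (mem S)) tensor_relators].

Fact tensor_rel_zmod_closed : zmod_closed tensor_rel.
Proof.
split; first by rewrite inE => S [[S0 _] _]; move: S0; rewrite inE.
move=> x y; rewrite !inE => xS yS S SP; have [[_ SB] _] := SP.
by have := SB x y; rewrite !inE; apply; [apply: xS|apply: yS].
Qed.

HB.instance Definition _ :=
  GRing.isZmodClosed.Build F tensor_rel tensor_rel_zmod_closed.

Definition tensor : Type := Quotient.quot (GRing.ZmodClosed.clone F tensor_rel _).
HB.instance Definition _ := GRing.Zmodule.on tensor.
HB.instance Definition _ := EqQuotient.on tensor.

Definition tensor_pi (x : F) : tensor := \pi_tensor x.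

Fact tensor_pi_is_zmod_morphism : zmod_morphism tensor_pi.
Proof. exact: pi_is_zmod_morphism. Qed.
HB.instance Definition _ :=
  GRing.isZmodMorphism.Build F tensor tensor_pi tensor_pi_is_zmod_morphism.

Lemma tensor_pi_eq x y : (tensor_pi x == tensor_pi y) = (x - y \in tensor_rel).
Proof.
by rewrite (Quotient.idealrBE (GRing.ZmodClosed.clone F tensor_rel _)).
Qed.

Definition pure_tensor (a : A) (v : V) : tensor := tensor_pi <[a, v]>.

Definition tensor_lift (W : zmodType) (b : A -> V -> W) (t : tensor) : W :=
  fglift (fun av : A * V => b av.1 av.2 : zmodule W) (repr t).

Lemma pure_tensor_balanced : balanced pure_tensor.
Proof.
have rel x : tensor_relators x -> x \in tensor_rel.
  by move=> xP; rewrite inE => S [_]; apply.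
split=> [a a' v|a v v'|r a v]; rewrite /pure_tensor -?raddfD; apply/eqP;
  rewrite tensor_pi_eq; apply: rel.
- by left; left; exists a, a', v.
- by left; right; exists a, v, v'.
- by right; exists r, a, v.
Qed.

(* Universal property: every balanced map factors uniquely through
   [pure_tensor]. *)
Section Lift.
Variables (W : zmodType) (b : A -> V -> W).
Hypothesis bP : balanced b.

Let L (x : F) : W := fglift (fun av : A * V => b av.1 av.2 : zmodule W) x.

Let LB : zmod_morphism L.
Proof.
exact: (@lift_is_additive int (A * V)%type (zmodule W)
  (fun av => b av.1 av.2)).
Qed.

Let LU a v : L <[a, v]> = b a v.
Proof. by rewrite /L liftU scale1r. Qed.

Let LD x y : L (x + y) = L x + L y.
Proof.
have L0 : L 0 = 0 by rewrite -[in LHS](subrr 0) LB subrr.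
have LN z : L (- z) = - L z by rewrite -[- z]sub0r LB L0 sub0r.
by rewrite -{1}[y]opprK LB LN opprK.
Qed.

Let L_rel x : x \in tensor_rel -> L x = 0.
Proof.
have [bD1 bD2 bZ] := bP; rewrite inE => /(_ [set y | L y = 0]); apply; split.
  split=> [|y z]; rewrite !inE /=; last by rewrite LB => -> ->; rewrite subrr.
  by rewrite -[in LHS](subrr 0) LB subrr.
move=> _ [[[a [a' [v ->]]]|[a [v [v' ->]]]]|[r [a [v ->]]]] /=;
  by rewrite LB ?LD !LU ?bD1 ?bD2 ?bZ subrr.
Qed.

Let tensor_liftE x : tensor_lift b (tensor_pi x) = L x.
Proof.
apply/eqP; rewrite -subr_eq0 -/(L _) -LB L_rel// -tensor_pi_eq.
by rewrite /tensor_pi reprK.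
Qed.

Lemma tensor_lift_is_zmod_morphism : zmod_morphism (tensor_lift b).
Proof.
move=> s t; rewrite -[s]reprK -[t]reprK -!/(tensor_pi _) -raddfB.
by rewrite !tensor_liftE LB.
Qed.

Lemma tensor_lift_pure a v : tensor_lift b (pure_tensor a v) = b a v.
Proof. by rewrite tensor_liftE LU. Qed.

End Lift.

Lemma tensor_lift_unique (W : zmodType) (g h : {additive tensor -> W}) :
  (forall a v, g (pure_tensor a v) = h (pure_tensor a v)) -> g =1 h.
Proof.
move=> gh t; rewrite -[t]reprK -/(tensor_pi _) -[repr t]freeg_sumE !raddf_sum.
apply: eq_bigr => -[a v] _; set c := coeff _ _.
have -> : Freeg [:: (c, (a, v))] = <[a, v]> *~ c.
  by rewrite freegU_mulz intz.
by rewrite !raddfMz -/(pure_tensor a v) gh.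
Qed.

End Tensor.

Section TensorMap.
Variables (R : nzRingType) (A B : lmodType R^c) (V : lmodType R).
Variable f : {linear A -> B}.

Definition tensor_map : tensor A V -> tensor B V :=
  tensor_lift (fun a v => pure_tensor (f a) v).

Lemma tensor_map_balanced :
  balanced (fun a (v : V) => pure_tensor (f a) v).
Proof.
have [bD1 bD2 bZ] := pure_tensor_balanced B V.
split=> [a a' v|a v v'|r a v]; last by rewrite linearZ bZ.
  by rewrite raddfD bD1.
by rewrite bD2.
Qed.

HB.instance Definition _ :=
  GRing.isZmodMorphism.Build (tensor A V) (tensor B V) tensor_map
    (tensor_lift_is_zmod_morphism tensor_map_balanced).

Lemma tensor_map_pure a v :
  tensor_map (pure_tensor a v) = pure_tensor (f a) v.
Proof. exact: tensor_lift_pure tensor_map_balanced a v. Qed.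

End TensorMap.
Arguments tensor_map {R A B} V f.

(* Main.v *)
(** The Ore condition gives common denominators, so every element of
    [A (x) Q] is a pure tensor [a (x) q], and such a tensor vanishes iff
    [q s = r] lies in [R] and [a r = 0] for some [s != 0].  For the nontrivial
    direction, let [phi_s] be the additive map on the free abelian group on
    pairs sending [(a, q)] to [a (q s)] when [q s] lies in [R]; the elements
    killed by [phi_s] for all nonzero [s] in some nonzero right ideal [s0 R]
    form a subgroup, by the Ore condition, and it contains the balancedness
    relators.  Essentiality of [f(A)] yields [r != 0] with [b r] in [f(A)], and
    then [b (x) q = b r (x) r^-1 q] is in the image of [f (x) 1]. *)
Require Import Defs.
From mathcomp Require Import all_boot all_order all_algebra.
From mathcomp Require Import boolp classical_sets functions.
From mathcomp.multinomials Require Import freeg.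

Set Implicit Arguments.
Unset Strict Implicit.
Unset Printing Implicit Defensive.

Import GRing.Theory.
Local Open Scope classical_set_scope.
Local Open Scope ring_scope.

(** * Submodules and essential submodules *)

Lemma set_neq0_ex (V : nmodType) (X : set V) :
  X <> [set 0] -> X 0 -> exists2 x, X x & x != 0.
Proof.
move=> Xn0 X0; apply: contrapT => nX; apply: Xn0.
apply/seteqP; split=> [x Xx|_ ->//] /=.
by apply: contrapT => /eqP x0; apply: nX; exists x.
Qed.

Lemma submoduleP (S : nzRingType) (M : lmodType S) (X : set M) :
  submodule X <->
  X 0 /\ forall s x y, X x -> X y -> X (s *: x + y).
Proof.
split=> -[X0 Xlin]; split; rewrite ?inE// in X0 *.
  by move=> s x y Xx Xy; have := Xlin s x y; rewrite !inE; apply.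
by move=> s x y; rewrite !inE; apply: Xlin.
Qed.

Lemma submodule0 (S : nzRingType) (M : lmodType S) (X : set M) :
  submodule X -> X 0.
Proof. by case/submoduleP. Qed.

Lemma submodule_scale (S : nzRingType) (M : lmodType S) (X : set M) s x :
  submodule X -> X x -> X (s *: x).
Proof.
by move=> /submoduleP[X0 Xlin] Xx; rewrite -[s *: x]addr0; apply: Xlin.
Qed.

Lemma submodule_range (S : nzRingType) (M N : lmodType S)
  (f : {linear M -> N}) : submodule (range f).
Proof.
apply/submoduleP; split=> [|s _ _ [x _ <-] [y _ <-]].
  by exists 0; rewrite ?raddf0.
by exists (s *: x + y); rewrite ?linearP.
Qed.

Lemma submoduleT (S : nzRingType) (M : lmodType S) : submodule [set: M].
Proof. by apply/submoduleP. Qed.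

Lemma submodule_line (S : nzRingType) (M : lmodType S) (m : M) :
  submodule (range (fun s : S => s *: m)).
Proof.
apply/submoduleP; split=> [|s _ _ [x _ <-] [y _ <-]].
  by exists 0; rewrite ?scale0r.
by exists (s * x + y); rewrite ?scalerDl ?scalerA.
Qed.

(** Essentiality is applied to the cyclic submodule generated by [m]. When [m] is zero this
    submodule is zero, and [s = 1] serves. *)
Lemma essential_ex_scale (S : nzRingType) (M : lmodType S) (N K : set M) m :
  essential N K -> K m -> exists2 s : S, s != 0 & N (s *: m).
Proof.
move=> [subN subK _ NK] Km; have N0 := submodule0 subN.
have [->|m0] := eqVneq m 0; first by exists 1; rewrite ?oner_neq0// scaler0.
have lineK : range (fun s : S => s *: m) `<=` K.
  by move=> _ [s _ <-]; apply: submodule_scale.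
have line_neq0 : range (fun s : S => s *: m) <> [set 0].
  move=> /seteqP[/(_ m) /= line0 _]; case/eqP: m0; apply: line0.
  by exists 1; rewrite ?scale1r.
have /set_neq0_ex[|x [Nx [s _ xE]] x0] :=
    NK _ (submodule_line m) lineK line_neq0.
  by split=> //; exists 0; rewrite ?scale0r.
rewrite -xE in Nx x0; exists s => //.
by apply: contraNneq x0 => ->; rewrite scale0r.
Qed.

Section OreLocalization.
Variables (R : nzRingType) (Q : unitRingType) (iota : {rmorphism R -> Q}).
Hypotheses (Rore : right_ore_domain R)
  (RQ : classical_right_fractions iota).
Local Notation V := (res_scalars iota).
Implicit Types A B C : lmodType R^c.

(** * Common multiples in [R] and denominators in [Q] *)

Lemma ore_mul_neq0 (a b : R) : a != 0 -> b != 0 -> a * b != 0.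
Proof.
by move=> a0 b0; apply/eqP => /Rore.1 /orP[]; rewrite ?(negPf a0) ?(negPf b0).
Qed.

Lemma ore_common_multiple (a b : R) : a != 0 -> b != 0 ->
  exists x y, a * x = b * y /\ a * x != 0.
Proof.
move=> a0 b0; have /set_neq0_ex[|_ [[x _ <-] [y _ yx]] x0] := Rore.2 _ _ a0 b0.
  by split; exists 0; rewrite ?mulr0.
by exists x, y.
Qed.

Lemma iota_unit (s : R) : s != 0 -> iota s \is a GRing.unit.
Proof.
have [Qfield inj_iota _] := RQ; move=> s0; apply: Qfield.
by rewrite -(rmorph0 iota) (inj_eq inj_iota).
Qed.

Lemma ex_denominator (q : Q) : exists2 s, s != 0 &
  exists r, iota r = q * iota s.
Proof.
have [_ _ /(_ q)[r [s [s0 ->]]]] := RQ.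
by exists s => //; exists r; rewrite divrK// iota_unit.
Qed.

Lemma ex_common_denominator (q q' : Q) : exists2 s, s != 0 &
  (exists r, iota r = q * iota s) /\ (exists r, iota r = q' * iota s).
Proof.
have [s s0 [r rE]] := ex_denominator q.
have [s' s'0 [r' r'E]] := ex_denominator q'.
have [x [y [xy x0]]] := ore_common_multiple s0 s'0.
exists (s * x) => //; split; first by exists (r * x); rewrite !rmorphM mulrA rE.
by exists (r' * y); rewrite xy !rmorphM mulrA r'E.
Qed.

(** * Pure tensors and when they vanish *)

Lemma pure_tensor0l A (q : V) : pure_tensor (0 : A) q = 0.
Proof.
have [D _ _] := pure_tensor_balanced A V.
by have /eqP := D 0 0 q; rewrite addr0 -subr_eq subrr eq_sym => /eqP.
Qed.

Lemma pure_tensorNl A (a : A) (q : V) : pure_tensor (- a) q = - pure_tensor a q.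
Proof.
have [D _ _] := pure_tensor_balanced A V.
by apply/eqP; rewrite -addr_eq0 -D addNr pure_tensor0l.
Qed.

Lemma pure_tensorMnl A (a : A) (q : V) n :
  pure_tensor (a *+ n) q = pure_tensor a q *+ n.
Proof.
have [D _ _] := pure_tensor_balanced A V.
by elim: n => [|n IHn]; rewrite ?pure_tensor0l// !mulrS D IHn.
Qed.

Lemma pure_tensor_num A (a : A) (q : Q) (r s : R) : s != 0 ->
  iota r = q * iota s ->
  pure_tensor a (q : V) = pure_tensor ((r : R^c) *: a) ((iota s)^-1 : V).
Proof.
move=> s0 rE; have [_ _ Z] := pure_tensor_balanced A V.
rewrite Z; congr pure_tensor.
by rewrite [RHS](_ : _ = iota r * (iota s)^-1)// rE mulrK// iota_unit.
Qed.

(** Over a common denominator [s], two pure tensors acquire the same second factor [s^-1] and add in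
    the first one. Integer coefficients are absorbed into the first factor. *)
Lemma pure_tensorP A (t : tensor A V) :
  exists (a : A) (q : V), t = pure_tensor a q.
Proof.
have [D _ _] := pure_tensor_balanced A V.
rewrite -[t]reprK -/(tensor_pi _) -[repr t]freeg_sumE raddf_sum.
apply: (big_ind (fun u => exists (a : A) (q : V), u = pure_tensor a q))
  => [|_ _ [a [q ->]] [a' [q' ->]]|[a q] _].
- by exists 0, 0; rewrite pure_tensor0l.
- have [s s0 [[r rE] [r' r'E]]] := ex_common_denominator q q'.
  exists ((r : R^c) *: a + (r' : R^c) *: a'), ((iota s)^-1 : Q).
  by rewrite D (pure_tensor_num a s0 rE) (pure_tensor_num a' s0 r'E).
- set c := coeff _ _; exists (a *~ c), q.
  rewrite -[c in LHS]intz -freegU_mulz raddfMz -/(pure_tensor a q).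
  by case: c => n; rewrite ?NegzE ?mulrNz ?pure_tensorNl -pmulrn pure_tensorMnl.
Qed.

(* The junk value [0] is returned when [q s] is not in the image of [R]. *)
Definition numerator (s : R) (q : Q) : R :=
  xget 0 [set r | iota r = q * iota s].

Lemma numeratorE s q r : iota r = q * iota s -> numerator s q = r.
Proof.
have [_ inj_iota _] := RQ; move=> rE; apply: xget_unique => // r' /= r'E.
by apply: inj_iota; rewrite rE r'E.
Qed.

(** This is [phi_s]. It stays on the free group: because of the junk values, a single [s] need not
    respect all relators. *)
Definition clear_denominator A (s : R) (x : {freeg (A * V) / int}) : A :=
  fglift (fun av : A * V => (numerator s av.2 : R^c) *: av.1 : zmodule A) x.

Lemma clear_denominatorB A s : zmod_morphism (@clear_denominator A s).
Proof.
exact: (@lift_is_additive int (A * V)%type (zmodule A)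
  (fun av => (numerator s av.2 : R^c) *: av.1)).
Qed.

Lemma clear_denominatorD A s (x y : {freeg (A * V) / int}) :
  clear_denominator s (x + y) = clear_denominator s x + clear_denominator s y.
Proof.
have c0 : @clear_denominator A s 0 = 0.
  by rewrite -[in LHS](subrr 0) clear_denominatorB subrr.
by rewrite -{1}[y]opprK -[- y]sub0r !clear_denominatorB c0 sub0r opprK.
Qed.

Lemma clear_denominatorU A s (a : A) (q : V) :
  clear_denominator s (Freeg [:: (1%:Z, (a, q))]) = (numerator s q : R^c) *: a.
Proof. by rewrite /clear_denominator liftU scale1r. Qed.

Lemma pure_tensor_eq0 A (a : A) (q : Q) : pure_tensor a (q : V) = 0 ->
  exists r s : R, [/\ s != 0, iota r = q * iota s & (r : R^c) *: a = 0].
Proof.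
move=> /eqP; rewrite -(raddf0 (@tensor_pi R A V)) tensor_pi_eq subr0 inE.
(* Asking for all nonzero multiples of a threshold [s0] lets two thresholds be replaced by a common
   multiple. *)
pose eventually0 := [set x : {freeg (A * V) / int} | exists2 s0, s0 != 0 &
  forall y, s0 * y != 0 -> clear_denominator (s0 * y) x = 0].
move=> /(_ eventually0)[|s0 s00 kill].
  split.
    split=> [|x x'].
      rewrite inE; exists 1; first exact: oner_neq0.
      by move=> y _; rewrite -[in LHS](subrr 0) clear_denominatorB subrr.
    rewrite !inE => -[s s0 sx] [s' s'0 sx'].
    have [u [v [uv u0]]] := ore_common_multiple s0 s'0.
    exists (s * u) => // y suy0; rewrite clear_denominatorB -mulrA sx ?mulrA//.
    by rewrite uv -mulrA sx' ?subrr// mulrA -uv.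
  move=> _ [[[b [b' [v ->]]]|[b [v [v' ->]]]]|[r [b [v ->]]]] /=.
  - exists 1; first exact: oner_neq0.
    move=> y _; rewrite clear_denominatorB clear_denominatorD.
    by rewrite !clear_denominatorU scalerDr subrr.
  (* Every multiple of a common denominator of [v] and [v'] gives genuine numerators, which add. *)
  - have [s s0 [[r rE] [r' r'E]]] := ex_common_denominator v v'.
    exists s => // y _; rewrite clear_denominatorB clear_denominatorD.
    rewrite !clear_denominatorU (@numeratorE _ v (r * y)); last first.
      by rewrite !rmorphM mulrA rE.
    rewrite (@numeratorE _ v' (r' * y)); last by rewrite !rmorphM mulrA r'E.
    rewrite (@numeratorE _ _ (r * y + r' * y)); last first.
      by rewrite rmorphD !rmorphM /= rE r'E -!mulrA -mulrDl.
    by rewrite [X in X - _](scalerDl b (r * y : R^c) (r' * y)) subrr.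
  - have [s s0 [w wE]] := ex_denominator v.
    exists s => // y _; rewrite clear_denominatorB !clear_denominatorU.
    rewrite (@numeratorE _ v (w * y)); last by rewrite !rmorphM mulrA wE.
    rewrite (@numeratorE _ _ (r * (w * y))); last first.
      by rewrite !rmorphM [iota w]wE !mulrA.
    by rewrite scalerA subrr.
(* A common multiple of the threshold and a denominator of [q] both kills the tensor and has a
   genuine numerator. *)
have [s s0' [r rE]] := ex_denominator q.
have [x [y [xy x0]]] := ore_common_multiple s00 s0'.
have ryE : iota (r * y) = q * iota (s0 * x) by rewrite xy !rmorphM mulrA rE.
exists (r * y), (s0 * x); split=> //.
by rewrite -(numeratorE ryE) -clear_denominatorU kill.
Qed.

(** * Essential images and surjectivity after tensoring *)

Lemma e_epi_tensor_surj A B (f : {linear A -> B}) :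
  e_epi f -> set_surj setT setT (tensor_map V f).
Proof.
move=> epif t _; have [b [q ->]] := pure_tensorP t.
have [//|r r0 [a _ fa]] := essential_ex_scale (m := b) epif.
exists (pure_tensor a ((iota r)^-1 * (q : Q) : V)) => //.
have [_ _ Z] := pure_tensor_balanced B V.
rewrite tensor_map_pure fa [LHS](Z r); congr pure_tensor.
by rewrite [LHS](_ : _ = iota r * ((iota r)^-1 * (q : Q)))// mulVKr// iota_unit.
Qed.

(** The right ideal [r R] annihilates [b], and it is essential by the Ore condition. *)
Lemma nonsingular_torsionfree B (b : B) (r : R) :
  nonsingular B -> r != 0 -> (r : R^c) *: b = 0 -> b = 0.
Proof.
move=> nsB r0 rb; suff : singular_submodule b by rewrite nsB.
exists (range (fun s : R^c => s *: (r : (R^c)^o))); split; last first.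
  by move=> _ [s _ <-]; rewrite -[LHS]scalerA rb scaler0.
split=> //; [exact: submodule_line|exact: submoduleT|].
move=> X subX _ Xn0; have X0 := submodule0 subX.
have [x Xx x0] := set_neq0_ex Xn0 X0.
have [u [v [uv u0]]] := ore_common_multiple r0 x0.
move=> /seteqP[/(_ (r * u)) /= rx0 _]; case/eqP: u0; apply: rx0.
split; first by exists u.
by rewrite uv; apply: (submodule_scale (v : R^c) subX Xx).
Qed.

(** Lifting [x (x) 1] to some [a (x) q] and clearing denominators makes [f(a) r - x s] a torsion
    element, hence zero. So [x s] lies in both [f(A)] and [X]. *)
Lemma tensor_surj_e_epi A B (f : {linear A -> B}) :
  set_surj setT setT (tensor_map V f) -> nonsingular B -> e_epi f.
Proof.
move=> surjf nsB; split=> //; [exact: submodule_range|exact: submoduleT|].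
move=> X subX _ Xn0 NX0; have X0 := submodule0 subX.
have [x Xx x0] := set_neq0_ex Xn0 X0.
have [t _ tx] := surjf (pure_tensor x ((1 : Q) : V)) I.
have [a [q tE]] := pure_tensorP t; rewrite tE tensor_map_pure in tx.
have [s s0 [r rE]] := ex_denominator q.
(* The denominator of [q] is also one for [1], so both sides get the second factor [s^-1]. *)
have sE : iota s = 1 * iota s by rewrite mul1r.
rewrite (pure_tensor_num _ s0 rE) (pure_tensor_num _ s0 sE) in tx.
have [D _ _] := pure_tensor_balanced B V.
have /pure_tensor_eq0[u [v [v0 uE u_kill]]] :
    pure_tensor ((r : R^c) *: f a - (s : R^c) *: x) ((iota s)^-1 : V) = 0.
  by rewrite D pure_tensorNl tx subrr.
(* In [Q], [u = s^-1 v] is a product of units. *)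
have u0 : u != 0.
  apply/eqP => u0; have := iota_unit v0.
  by rewrite -(mulVKr (iota_unit s0) (iota v)) -uE u0 rmorph0 mulr0 unitr0.
have /eqP := nonsingular_torsionfree nsB u0 u_kill.
rewrite subr_eq0 => /eqP raE.
case/eqP: x0; apply: (nonsingular_torsionfree nsB s0).
have : (range f `&` X) ((s : R^c) *: x); last by rewrite NX0.
split; last exact: submodule_scale.
by exists ((r : R^c) *: a); rewrite ?linearZ.
Qed.

(** * Exactness of the tensored sequence *)

Lemma tensor_map_inj A B (f : {linear A -> B}) :
  injective f -> injective (tensor_map V f).
Proof.
move=> injf; apply: raddf_inj => t; have [a [q ->]] := pure_tensorP t.
rewrite /= tensor_map_pure => /pure_tensor_eq0[r [s [s0 rE]]].
rewrite -linearZ -(raddf0 f) => /injf ra0.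
by rewrite (pure_tensor_num _ s0 rE) ra0 pure_tensor0l.
Qed.

Lemma short_e_exact_tensor A B C (f : {linear A -> B}) (g : {linear B -> C}) :
  short_e_exact f g -> short_exact (tensor_map V f) (tensor_map V g).
Proof.
move=> [injf gf0 essf epig]; split.
- exact: tensor_map_inj.
- apply/seteqP; split=> [_ [t _ <-]|t] /=.
    have [a [q ->]] := pure_tensorP t.
    by rewrite !tensor_map_pure gf0 pure_tensor0l.
  have [b [q ->]] := pure_tensorP t.
  rewrite tensor_map_pure => /pure_tensor_eq0[r [s [s0 rE]]].
  rewrite -linearZ => gb0.
  (* Only [b r] is known to lie in the kernel of [g], so essentiality is used there; then [b (x) q =
     b r (x) s^-1 = b r u (x) u^-1 s^-1]. *)
  have [u u0 [a _ fa]] := essential_ex_scale essf gb0.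
  exists (pure_tensor a ((iota u)^-1 * (iota s)^-1 : V)) => //.
  have [_ _ Z] := pure_tensor_balanced B V.
  rewrite tensor_map_pure fa (pure_tensor_num _ s0 rE) [LHS](Z u).
  congr pure_tensor.
  by rewrite [LHS](_ : _ = iota u * ((iota u)^-1 * (iota s)^-1))// mulVKr
    ?iota_unit.
- exact: e_epi_tensor_surj.
Qed.

End OreLocalization.

Theorem lemma3p7 (R : nzRingType) (Q : unitRingType)
    (iota : {rmorphism R -> Q}) (Rore : right_ore_domain R)
    (RQ : classical_right_fractions iota) :
  (forall (A B : lmodType R^c) (f : {linear A -> B}),
     let fQ := tensor_map (res_scalars iota) f in
     (e_epi f -> set_surj setT setT fQ) /\
     (set_surj setT setT fQ -> nonsingular B -> e_epi f)) /\
  (forall (A B C : lmodType R^c) (f : {linear A -> B}) (g : {linear B -> C}),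
     short_e_exact f g ->
     short_exact (tensor_map (res_scalars iota) f)
                 (tensor_map (res_scalars iota) g)).
Proof.
split=> [A B f fQ|A B C f g]; last exact: short_e_exact_tensor.
by split; [exact: e_epi_tensor_surj|exact: tensor_surj_e_epi].
Qed.
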